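(* Let $\{A,B\}$ be an adjoint pair on a Hilbert space $\mathcal{H}$ such that $0$ is a regular point for $A$ and $B$. Suppose that $B$ is a closed formally normal operator and $\mathcal{D}(A)=\mathcal{D}(B)$. Let $R$ be the associated operator described in the context. Let $\mathcal{C}$ be a closed linear subspace of $\mathcal{K}=\mathcal{N}(A^* )\oplus\mathcal{N}(B^* )$ satisfying the following two conditions: (i) $\{(R^* )^{-1}v_1+u_1:\ (u_1,v_1)\in\mathcal{C}\}=\{R^{-1}u_2+v_2:\ (u_2,v_2)\in\mathcal{C}'\}$; (ii) if $(u_1,v_1)\in\mathcal{C}$, $(u_2,v_2)\in\mathcal{C}'$ and $(R^* )^{-1}v_1+u_1=R^{-1}u_2+v_2$, then $\|v_1\|=\|u_2\|$. Then $T_{\mathcal{C}}$ is a normal operator on $\mathcal{H}$ such that $B\subseteq T_{\mathcal{C}}\subseteq A^*$ and $A\subseteq(T_{\mathcal{C}})^*\subseteq B^*$. Each normal extension of $B$ on $\mathcal{H}$ is of this form, that is, it equals $T_{\mathcal{C}}$ for some closed linear subspace $\mathcal{C}$ of $\mathcal{K}$ satisfying (i) and (ii).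
   Context: $\mathcal{D}(T)$ and $\mathcal{N}(T)$ denote the domain and the kernel of an operator $T$; $\dot{+}$ is the direct sum of vector spaces; $T\lceil\mathcal{D}$ is the restriction of $T$ to $\mathcal{D}$. An adjoint pair $\{A,B\}$ is a pair of densely defined linear operators on $\mathcal{H}$ with $\langle Ax,y\rangle=\langle x,By\rangle$ for $x\in\mathcal{D}(A)$, $y\in\mathcal{D}(B)$. The number $0$ is a regular point for $T$ if there is $\gamma>0$ with $\|T\varphi\|\ge\gamma\|\varphi\|$ for all $\varphi\in\mathcal{D}(T)$. A densely defined operator $T$ is formally normal if $\mathcal{D}(T)\subseteq\mathcal{D}(T^* )$ and $\|Tx\|=\|T^*x\|$ for $x\in\mathcal{D}(T)$; it is normal if in addition $\mathcal{D}(T)=\mathcal{D}(T^* )$. Associated operator $R$: a fixed closed operator $R$ on $\mathcal{H}$ such that $R$ and $R^*$ have bounded everywhere defined inverses, $A\subseteq R\subseteq B^*$, $B\subseteq R^*\subseteq A^*$ (it exists by a theorem of Vishik); it satisfies $$\mathcal{D}(A^* )=\mathcal{D}(B)\dot{+}(R^* )^{-1}\mathcal{N}(B^* )\dot{+}\mathcal{N}(A^* ),\qquad \mathcal{D}(B^* )=\mathcal{D}(A)\dot{+}R^{-1}\mathcal{N}(A^* )\dot{+}\mathcal{N}(B^* ).$$ For a closed subspace $\mathcal{C}$ of $\mathcal{K}$ set $T_{\mathcal{C}}=A^*\lceil\mathcal{D}(T_{\mathcal{C}})$, where $$\mathcal{D}(T_{\mathcal{C}})=\{x_0+(R^* )^{-1}v_1+u_1:\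 x_0\in\mathcal{D}(B),\ (u_1,v_1)\in\mathcal{C}\},$$ and let $\mathcal{C}'=\{(u_2,v_2)\in\mathcal{K}:\ \langle v_1,v_2\rangle=\langle u_1,u_2\rangle\ \text{for all}\ (u_1,v_1)\in\mathcal{C}\}$. *)

(* Defs.v *)
From HB Require Import structures.
From mathcomp Require Import all_boot all_order all_algebra.
From mathcomp Require Import complex.
From mathcomp Require Import all_classical all_reals all_analysis.

Set Implicit Arguments.
Unset Strict Implicit.
Unset Printing Implicit Defensive.

Import Order.TTheory GRing.Theory Num.Theory.
Import numFieldNormedType.Exports.

Local Open Scope classical_set_scope.
Local Open Scope ring_scope.

(* Complex Hilbert spaces. The inner product is linear in its first argument
   and conjugate-linear in the second one. As in any normed module over
   K[i], the norm `|x| is an element of K[i]; it is real and nonnegative. *)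
Record hilbert (K : realType) := Hilbert {
  hilbert_sort :> completeNormedModType K[i];
  hdot : {dot hilbert_sort for (@Num.conj K[i])};
  hdot_norm : forall x : hilbert_sort, `|x| ^+ 2 = hdot x x }.

Notation "'[ x , y ]" := (hdot _ x y) : ring_scope.

(* A possibly unbounded operator: a domain and a function whose values matter
   on the domain only. Linearity is the separate predicate [linear_op]. *)
Record operator (K : realType) (H : hilbert K) := Operator {
  dom : set H;
  op_fun :> H -> H }.

Definition linear_subspace (K : realType) (V : lmodType K[i]) (D : set V)
  : Prop := GRing.submod_closed (mem D).

Definition linear_op (K : realType) (H : hilbert K) (T : operator H) : Prop :=
  linear_subspace (dom T) /\
  forall (a : K[i]) (x y : H), dom T x -> dom T y ->
    T (a *: x + y) = a *: T x + T y.

Definition densely_defined (K : realType) (H : hilbert K) (T : operator H)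
  : Prop := dense (dom T).

Definition graph (K : realType) (H : hilbert K) (T : operator H)
  : set (H * H) := [set p | dom T p.1 /\ T p.1 = p.2].

Definition closed_op (K : realType) (H : hilbert K) (T : operator H) : Prop :=
  closed (graph T).

Definition kernel (K : realType) (H : hilbert K) (T : operator H) : set H :=
  [set x | dom T x /\ T x = 0].

Definition op_le (K : realType) (H : hilbert K) (S T : operator H) : Prop :=
  dom S `<=` dom T /\ forall x, dom S x -> S x = T x.

Definition op_eq (K : realType) (H : hilbert K) (S T : operator H) : Prop :=
  op_le S T /\ op_le T S.

(* Meant for D contained in the domain of T. *)
Definition restriction (K : realType) (H : hilbert K) (T : operator H)
  (D : set H) : operator H := Operator D T.

Definition adjoint_graph (K : realType) (H : hilbert K) (T : operator H)
  (y z : H) : Prop := forall x, dom T x -> '[T x, y] = '[x, z].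

(* For T densely defined, the z chosen by xget is the only one there is. *)
Definition adjoint (K : realType) (H : hilbert K) (T : operator H)
  : operator H :=
  Operator [set y | exists z, adjoint_graph T y z]
           (fun y => xget 0 [set z | adjoint_graph T y z]).

(* For T injective on its domain, the x chosen by xget is the only one. *)
Definition inverse (K : realType) (H : hilbert K) (T : operator H)
  : operator H :=
  Operator [set y | exists2 x, dom T x & T x = y]
           (fun y => xget 0 [set x | dom T x /\ T x = y]).

Definition has_bounded_everywhere_defined_inverse (K : realType)
  (H : hilbert K) (T : operator H) : Prop :=
  [/\ forall x y, dom T x -> dom T y -> T x = T y -> x = y,
      dom (inverse T) = setT
    & exists M : K[i], forall y, `|inverse T y| <= M * `|y| ].

Definition adjoint_pair (K : realType) (H : hilbert K) (A B : operator H)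
  : Prop :=
  [/\ linear_op A /\ densely_defined A,
      linear_op B /\ densely_defined B
    & forall x y, dom A x -> dom B y -> '[A x, y] = '[x, B y] ].

(* In K[i], 0 < g forces g to be real. *)
Definition zero_regular (K : realType) (H : hilbert K) (T : operator H)
  : Prop :=
  exists2 g : K[i], 0 < g & forall x, dom T x -> g * `|x| <= `|T x|.

Definition formally_normal (K : realType) (H : hilbert K) (T : operator H)
  : Prop :=
  [/\ linear_op T, densely_defined T, dom T `<=` dom (adjoint T)
    & forall x, dom T x -> `|T x| = `|adjoint T x| ].

Definition normal_op (K : realType) (H : hilbert K) (T : operator H) : Prop :=
  formally_normal T /\ dom T = dom (adjoint T).

Definition associated (K : realType) (H : hilbert K) (A B R : operator H)
  : Prop :=
  [/\ linear_op R /\ closed_op R,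
      has_bounded_everywhere_defined_inverse R,
      has_bounded_everywhere_defined_inverse (adjoint R),
      op_le A R /\ op_le R (adjoint B)
    & op_le B (adjoint R) /\ op_le (adjoint R) (adjoint A) ].

(* The direct sum of N(A^* ) and N(B^* ), as a subset of H * H. The norm of H * H in the library
   is the maximum of the two norms; it induces the same topology as the
   Hilbert space direct sum. *)
Definition Kspace (K : realType) (H : hilbert K) (A B : operator H)
  : set (H * H) := kernel (adjoint A) `*` kernel (adjoint B).

(* Kspace A B is closed in H * H, so that closedness of C in H * H and in
   Kspace A B coincide. *)
Definition closed_subspace_of_Kspace (K : realType) (H : hilbert K)
  (A B : operator H) (C : set (H * H)) : Prop :=
  [/\ C `<=` Kspace A B, linear_subspace C & closed C].

Definition Cprime (K : realType) (H : hilbert K) (A B : operator H)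
  (C : set (H * H)) : set (H * H) :=
  [set p | Kspace A B p /\ forall q, C q -> '[q.2, p.2] = '[q.1, p.1] ].

Definition TC (K : realType) (H : hilbert K) (A B R : operator H)
  (C : set (H * H)) : operator H :=
  restriction (adjoint A)
    [set x | exists x0 u1 v1, [/\ dom B x0, C (u1, v1)
                                & x = x0 + inverse (adjoint R) v1 + u1] ].

Definition condition_i (K : realType) (H : hilbert K) (A B R : operator H)
  (C : set (H * H)) : Prop :=
  [set inverse (adjoint R) p.2 + p.1 | p in C] =
  [set inverse R p.1 + p.2 | p in Cprime A B C].

Definition condition_ii (K : realType) (H : hilbert K) (A B R : operator H)
  (C : set (H * H)) : Prop :=
  forall u1 v1 u2 v2 : H, C (u1, v1) -> Cprime A B C (u2, v2) ->
    inverse (adjoint R) v1 + u1 = inverse R u2 + v2 -> `|v1| = `|u2|.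

(* Main.v *)
Require Import Defs.
From mathcomp Require Import all_boot all_order all_algebra.
From mathcomp Require Import complex ring.
From mathcomp Require Import all_classical all_reals all_analysis.

(** Abbreviate A' and B' for the adjoints of A and B and R' for that of R, and
    write lift (u, v) = R'^-1 v + u and lift' (u, v) = R^-1 u + v for (u, v) in
    the sum of N(A') and N(B').

    The statement rests on a boundary form. Since B is closed and bounded
    below, its range is closed, so by orthogonal projection every w is B x0 + v
    with v in N(B') ([regular_range_decomposition]). Applying this to
    w = A' x and subtracting x0 + R'^-1 v, which A' also maps to w, gives
    x = x0 + lift (u, v), with A' x = B x0 + v an orthogonal sum
    ([adjoint_domain_decomposition]). The same holds for B', with A and R
    in place of B and R'; A is closed because formal normality of B means that
    A and B have equal norms on their common domain. Green's identity
    ([green_identity]) says that the defect <A' x, y> - <x, B' y> depends on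
    the boundary parts only and equals <v1, v2> - <u1, u2>. Hence the adjoint
    of T_C is the restriction of B' to the vectors whose boundary part lies in
    C' ([dom_adjoint_TC]).

    Given (i) and (ii), T_C and its adjoint have the same domain, because
    D(A) = D(B), and a vector of it has the same component x0 in both
    decompositions. The norms of T_C and its adjoint agree there by
    orthogonality: |B x0| = |A x0| and, by (ii), |v1| = |u2|.

    Conversely, a normal extension N of B lies below A', so N = T_C for the set
    C of all pairs whose lift is in D(N). C is closed because N is closed: its
    adjoint is closed and has the same domain and norms. To see (i), let
    x0 + lift p = y0 + lift' q be a vector of D(N). Moving y0 - x0 from one side
    to the other and comparing norms twice yields
      |p.2|^2 = |A (y0 - x0)|^2 + |q.1|^2  and
      |q.1|^2 = |B (x0 - y0)|^2 + |p.2|^2,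
    so x0 = y0 as B is bounded below ([normal_TC_same_core]). Both (i) and (ii)
    follow. *)

Set Implicit Arguments.
Unset Strict Implicit.
Unset Printing Implicit Defensive.

Import Order.TTheory GRing.Theory Num.Theory.
Import numFieldNormedType.Exports.

Local Open Scope classical_set_scope.
Local Open Scope ring_scope.

(** * Limits and closed sets described by norms *)

(** The scalar field is only partially ordered when it is complex, so minima of
    positive numbers have to be taken through the fact that these are real. *)
Lemma gt0_common (R : numDomainType) (d e : R) : 0 < d -> 0 < e ->
  exists2 c : R, 0 < c & c <= d /\ c <= e.
Proof.
move=> d0 e0.
by have [de|ed] := real_leP (gtr0_real d0) (gtr0_real e0);
  [exists d|exists e => //; split=> //; exact: ltW].
Qed.

Lemma le_scaled_eps0 (R : numFieldType) (t c : R) :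
  0 <= t -> (forall e : R, 0 < e -> t <= e * c) -> t = 0.
Proof.
move=> t0 tle; apply/eqP/negPn/negP => tN0; suff: t < t by rewrite ltxx.
have {tN0} {}t0 : 0 < t by rewrite lt_def tN0.
have c0 : 0 < c by rewrite (lt_le_trans t0) // -[c]mul1r tle.
have := tle (t / 2 / c) (divr_gt0 (divr_gt0 t0 (ltr0Sn _ 1)) c0).
rewrite divfK ?gt_eqF // => /le_lt_trans; apply.
by rewrite ltr_pdivrMr // mulr_natr mulr2n ltrDl.
Qed.

Lemma dense_superset (T : topologicalType) (S D : set T) :
  S `<=` D -> dense S -> dense D.
Proof.
by move=> SD Sd U U0 Uo; have [x [Ux /SD Dx]] := Sd U U0 Uo; exists x.
Qed.

Section normed_module.
Variables (R : numFieldType) (V : normedModType R).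
Implicit Types (x y : V) (e : R).

Lemma closed_normP (S : set V) :
  closed S <->
  forall x, (forall e, 0 < e -> exists2 s, S s & `|x - s| < e) -> S x.
Proof.
split=> [Scl x Sx|Sx x clx].
- apply: Scl => U /nbhs_ballP[e /= e0 eU].
  have [s Ss xs] := Sx e e0.
  by exists s; split=> //; apply: eU; rewrite -ball_normE.
- apply: Sx => e e0; have [s [Ss xs]] := clx _ (nbhsx_ballx x e e0).
  by exists s => //; move: xs; rewrite -ball_normE.
Qed.

Lemma closed_prodP (G : set (V * V)) :
  closed G <->
  forall x y, (forall e, 0 < e -> exists p,
     [/\ G p, `|x - p.1| < e & `|y - p.2| < e]) -> G (x, y).
Proof.
split=> [Gcl x y Gxy|Gxy [x y] clxy].
- apply: Gcl => U /nbhs_ballP[e /= e0 eU].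
  have [p [Gp x_p y_p]] := Gxy e e0.
  by exists p; split=> //; apply: eU; split; rewrite -ball_normE.
- apply: Gxy => e e0.
  have [p [Gp [x_p y_p]]] := clxy _ (nbhsx_ballx (x, y) e e0).
  by exists p; split=> //; [move: x_p|move: y_p]; rewrite -ball_normE.
Qed.

Lemma dense_approx (S : set V) x e : dense S -> 0 < e ->
  exists2 s, S s & `|x - s| < e.
Proof.
move=> Sdense e0.
have [|s [xs Ss]] := Sdense _ _ (open_interior (ball x e)).
  by exists x; exact: nbhsx_ballx.
by exists s => //; move/interior_subset: xs; rewrite -ball_normE.
Qed.

End normed_module.

(** The form in which completeness is used: the sets [P e] replace a Cauchy
    sequence, which avoids choosing one. The conclusion still gives a member of
    [P d] close to the limit, so whatever [P] records about its members can be
    passed to the limit. *)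
Lemma limit_of_shrinking_sets (R : numFieldType) (V : completeNormedModType R)
    (P : R -> set V) :
    (forall e, 0 < e -> P e !=set0) ->
    (forall d e, d <= e -> P d `<=` P e) ->
    (forall e, 0 < e -> exists2 d, 0 < d &
       forall x y, P d x -> P d y -> `|x - y| < e) ->
  exists p, forall d e, 0 < d -> 0 < e -> exists2 x, P d x & `|p - x| < e.
Proof.
move=> P0 Pmono Pdiam.
pose F := filter_from [set d : R | 0 < d] P.
have FF : ProperFilter F.
  apply: filter_from_proper; last exact: P0.
  apply: filter_from_filter; first by exists 1 => /=.
  move=> d e d0 e0; have [c c0 [cd ce]] := gt0_common d0 e0.
  by exists c => // x Px; split; [exact: Pmono cd _ Px|exact: Pmono ce _ Px].
have /cauchy_cvgP/cvg_ex[p Fp] : cauchy F.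
  apply: cauchy_exP => e e0; have [d d0 Pd] := Pdiam e e0.
  have [x Px] := P0 d d0; exists x; exists d => // y Py.
  by rewrite -ball_normE; exact: Pd.
exists p => d e d0 e0.
have [c c0 Pc] := Fp _ (nbhsx_ballx p e e0).
have [b b0 [bd bc]] := gt0_common d0 c0.
have [x Px] := P0 b b0; exists x; first exact: Pmono bd _ Px.
by have := Pc x (Pmono _ _ bc _ Px); rewrite -ball_normE.
Qed.

(** * Inner products and orthogonal projection *)

Lemma linear_subspaceP (K : realType) (V : lmodType K[i]) (E : set V) :
  linear_subspace E <->
  E 0 /\ forall (a : K[i]) (v w : V), E v -> E w -> E (a *: v + w).
Proof.
split=> -[E0 El]; split.
- by move: E0; rewrite inE.
- by move=> a v w Ev Ew; have := El a v w; rewrite !inE; apply.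
- by rewrite inE.
- by move=> a v w; rewrite !inE; exact: El.
Qed.

(** A set of nonnegative complex numbers is real, so it has the infimum of its
    real parts; squared norms are such numbers. *)
Lemma nonneg_inf (K : realType) (E : set K[i]) :
    E !=set0 -> (forall t, E t -> 0 <= t) ->
  exists m, (forall t, E t -> m <= t) /\
            (forall d, 0 < d -> exists2 t, E t & t < m + d).
Proof.
move=> [t0 Et0] E0; pose E' := [set complex.Re t | t in E].
have E'lb : has_lbound E'.
  by exists 0 => _ [t /E0 + <-]; rewrite lecE => /andP[].
have Einf : has_inf E' by split=> //; exists (complex.Re t0); exists t0.
exists (inf E' +i* 0)%C; split=> [t Et|d].
- rewrite lecE /=; have := E0 t Et; rewrite lecE /= => /andP[-> _] /=.
  by apply: ge_inf => //; exists t.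
- rewrite ltcE /= => /andP[/eqP dIm dRe].
  have [_ [t Et <-] tlt] := inf_adherent dRe Einf.
  exists t => //; case: d dIm dRe tlt => a b /= -> _ tlt.
  rewrite ltcE /= addr0 tlt andbT.
  by have := E0 t Et; rewrite lecE /= eq_sym => /andP[].
Qed.

Section inner_product.
Variables (K : realType) (H : hilbert K).
Implicit Types (x y z : H) (d e : K[i]) (S : set H).

Lemma hdotDl x y z : '[x + y, z] = '[x, z] + '[y, z].
Proof. by rewrite linearDl. Qed.

Lemma hdotBl x y z : '[x - y, z] = '[x, z] - '[y, z].
Proof. by rewrite linearBl. Qed.

Lemma hdotDr x y z : '[z, x + y] = '[z, x] + '[z, y].
Proof. by rewrite linearDr. Qed.

Lemma hdotBr x y z : '[z, x - y] = '[z, x] - '[z, y].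
Proof. by rewrite linearBr. Qed.

Lemma hdotZl (a : K[i]) x z : '[a *: x, z] = a * '[x, z].
Proof. by rewrite linearZl_LR. Qed.

Lemma hdotZr (a : K[i]) x z : '[z, a *: x] = a^* * '[z, x].
Proof. by rewrite linearZr_LR. Qed.

Lemma hdotC x z : '[z, x] = ('[x, z])^*.
Proof. by rewrite hermC /= expr0 mul1r. Qed.

Lemma hdot_eq0C x y : '[x, y] = 0 -> '[y, x] = 0.
Proof. by move=> xy; rewrite hdotC xy rmorph0. Qed.

Lemma pythagoras x y : '[x, y] = 0 -> `|x + y| ^+ 2 = `|x| ^+ 2 + `|y| ^+ 2.
Proof. by move=> xy; rewrite !hdot_norm hnormDd. Qed.

Lemma parallelogram x y :
  `|x + y| ^+ 2 + `|x - y| ^+ 2 = 2 * (`|x| ^+ 2 + `|y| ^+ 2).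
Proof.
rewrite !hdot_norm !(hdotBl, hdotBr, hdotDl, hdotDr).
by ring.
Qed.

(** The gain in norm obtained by removing the component along [y]: it gives the
    Cauchy-Schwarz inequality, and near-orthogonality of near-minimizers in
    [orthogonal_projection]. *)
Lemma sqr_norm_reject x y : y != 0 ->
  `|x - ('[x, y] / `|y| ^+ 2) *: y| ^+ 2
    = `|x| ^+ 2 - `|'[x, y]| ^+ 2 / `|y| ^+ 2.
Proof.
move=> y0; set c := _ / _.
have n0 : `|y| ^+ 2 != 0 by rewrite expf_eq0 /= normr_eq0.
have xyE : '[x, y] = c * `|y| ^+ 2 by rewrite divfK.
have xcy : '[x - c *: y, c *: y] = 0.
  by rewrite hdotBl hdotZl !hdotZr -hdot_norm xyE; ring.
rewrite -{2}[x](subrK (c *: y)) (pythagoras xcy) xyE.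
rewrite normrM normrX normr_id normrZ !exprMn -expr2 expr2.
by field; rewrite normr_eq0.
Qed.

Lemma cauchy_schwarz x y : `|'[x, y]| <= `|x| * `|y|.
Proof.
have [->|y0] := eqVneq y 0; first by rewrite linear0r !normr0 mulr0.
have n0 : 0 < `|y| ^+ 2 by rewrite exprn_gt0 // normr_gt0.
rewrite -ler_sqr ?nnegrE ?mulr_ge0 // exprMn -ler_pdivrMr //.
by rewrite -subr_ge0 -sqr_norm_reject // exprn_ge0.
Qed.

Lemma dense_orthogonal S z : dense S -> (forall s, S s -> '[s, z] = 0) -> z = 0.
Proof.
move=> Sdense Sz; apply/eqP; rewrite -normr_eq0 -sqrf_eq0; apply/eqP.
apply: (@le_scaled_eps0 _ _ `|z|) => [|e e0]; first exact: exprn_ge0.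
have [s Ss zs] := dense_approx z Sdense e0.
rewrite -[leLHS]ger0_norm ?exprn_ge0 // hdot_norm -{1}(subrK s z).
rewrite hdotDl (Sz s Ss) addr0.
by apply: le_trans (cauchy_schwarz _ _) _; rewrite ler_wpM2r // ltW.
Qed.

Lemma hdot_eq_closed (a b y z : H) :
  (forall e, 0 < e -> exists p : H * H,
     [/\ '[a, p.1] = '[b, p.2], `|y - p.1| < e & `|z - p.2| < e]) ->
  '[a, y] = '[b, z].
Proof.
move=> app; apply/eqP; rewrite -subr_eq0 -normr_eq0; apply/eqP.
apply: (@le_scaled_eps0 _ _ (`|a| + `|b|)) => // e e0.
have [[y' z'] /= [ab yy' zz']] := app e e0.
have -> : '[a, y] - '[b, z] = '[a, y - y'] - '[b, z - z'].
  by rewrite !hdotBr ab; ring.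
apply: le_trans (ler_normB _ _) _; rewrite mulrDr.
by apply: lerD; apply: le_trans (cauchy_schwarz _ _) _;
  rewrite mulrC ler_wpM2r // ltW.
Qed.

(** Points of [S] nearly minimizing the distance to [w] form shrinking sets by
    the parallelogram law applied to their midpoint, and [p] is their limit.
    Orthogonality holds up to an error for every near-minimizer, since
    correcting it along [q] cannot beat the minimum, and exactly in the limit. *)
Lemma orthogonal_projection S w : linear_subspace S -> closed S ->
  exists2 p, S p & forall q, S q -> '[w - p, q] = 0.
Proof.
move=> /linear_subspaceP[S0 Slin] /closed_normP Scl.
(* m is the squared distance from w to S. *)
have [m [mle mlt]] : exists m, (forall s, S s -> m <= `|w - s| ^+ 2) /\
    (forall d, 0 < d -> exists2 s, S s & `|w - s| ^+ 2 < m + d).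
  have [|_ [s _ <-]|m [mle mlt]] :=
    @nonneg_inf K [set `|w - s| ^+ 2 | s in S].
  - by exists (`|w - 0| ^+ 2), 0.
  - exact: exprn_ge0.
  - exists m; split=> [s Ss|d d0]; first by apply: mle; exists s.
    by have [_ [s Ss <-] lt] := mlt d d0; exists s.
pose P d := [set s | S s /\ `|w - s| ^+ 2 < m + d].
have [|d e de s [Ss sd]|e e0|p pP] := @limit_of_shrinking_sets _ H P.
- by move=> d d0; have [s Ss sd] := mlt d d0; exists s.
- by split=> //; apply: lt_le_trans sd _; rewrite lerD2l.
- (* The midpoint is at squared distance at least m from w, hence
     |s - t| ^+ 2 < 4 * (e ^+ 2 / 4). *)
  exists (e ^+ 2 / 4); first by rewrite divr_gt0 ?exprn_gt0.
  move=> s t [Ss sm] [St tm].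
  have Sst : S (2^-1 *: (s + t)).
    rewrite -[_ *: _]addr0; apply: (Slin) => //.
    by rewrite -[s]scale1r; exact: Slin.
  have mid : `|(w - s) + (w - t)| ^+ 2 = 4 * `|w - 2^-1 *: (s + t)| ^+ 2.
    have -> : (w - s) + (w - t) = 2 *: (w - 2^-1 *: (s + t)).
      rewrite scalerBr scalerA divff ?pnatr_eq0 // scale1r.
      by rewrite scaler_nat mulr2n opprD addrACA.
    by rewrite normrZ exprMn ger0_norm // -natrX.
  have := parallelogram (w - s) (w - t).
  rewrite mid (_ : (w - s) - (w - t) = t - s); last first.
    by rewrite opprB addrC addrA subrK.
  move=> /(canRL (addKr _)) st2.
  rewrite distrC -ltr_sqr ?nnegrE ?(ltW e0) // st2.
  have := mle _ Sst => {}mle.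
  have lt2 := ltrD sm tm.
  rewrite [- _ + _]addrC ltrBlDr.
  apply: (@lt_le_trans _ _ (2 * (m + e ^+ 2 / 4 + (m + e ^+ 2 / 4)))).
    by rewrite ltr_pM2l.
  rewrite (_ : 2 * _ = e ^+ 2 + 4 * m); last by field.
  by rewrite lerD2l ler_pM2l.
have Sp : S p.
  by apply: Scl => e e0; have [s [Ss _] ps] := pP e e e0 e0; exists s.
exists p => // q Sq.
have [->|q0] := eqVneq q 0; first by rewrite linear0r.
apply: normr0_eq0; apply: (@le_scaled_eps0 _ _ (2 * `|q|)) => // e e0.
have [s [Ss sm] ps] := pP (e ^+ 2) e (exprn_gt0 _ e0) e0.
have sq : `|'[w - s, q]| <= e * `|q|.
  rewrite -ler_sqr ?nnegrE ?mulr_ge0 ?(ltW e0) // exprMn.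
  rewrite -ler_pdivrMr ?exprn_gt0 ?normr_gt0 //.
  set c := '[w - s, q] / `|q| ^+ 2.
  have Scs : S (c *: q + s) by exact: Slin.
  have := mle _ Scs; rewrite opprD addrCA addrC sqr_norm_reject // => mc.
  rewrite -(lerD2l m); apply: ltW; apply: le_lt_trans sm.
  by rewrite -lerBrDr.
rewrite (_ : w - p = (w - s) - (p - s)); last by rewrite opprB addrA subrK.
rewrite hdotBl; apply: le_trans (ler_normB _ _) _.
rewrite mulrCA mulr_natl mulr2n; apply: lerD => //.
by apply: le_trans (cauchy_schwarz _ _) _; rewrite ler_wpM2r // ltW.
Qed.

End inner_product.

(** * Linear operators, adjoints and inverses *)

Section operators.
Variables (K : realType) (H : hilbert K).
Implicit Types (x y z : H) (d e : K[i]) (T : operator H).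

Lemma linear_op_dom0 T : linear_op T -> dom T 0.
Proof. by case=> /linear_subspaceP[]. Qed.

Lemma linear_op_dom T (a : K[i]) x y :
  linear_op T -> dom T x -> dom T y -> dom T (a *: x + y).
Proof. by case=> /linear_subspaceP[_ Tlin] _; exact: Tlin. Qed.

Lemma linear_opD T x y : linear_op T -> dom T x -> dom T y ->
  dom T (x + y) /\ T (x + y) = T x + T y.
Proof.
move=> Tl Tx Ty; rewrite -[x in x + y]scale1r.
by split; [exact: linear_op_dom|rewrite (proj2 Tl) // scale1r].
Qed.

Lemma linear_opB T x y : linear_op T -> dom T x -> dom T y ->
  dom T (x - y) /\ T (x - y) = T x - T y.
Proof.
move=> Tl Tx Ty; rewrite addrC -scaleN1r.
by split; [exact: linear_op_dom|rewrite (proj2 Tl) // scaleN1r addrC].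
Qed.

Lemma linear_op0 T : linear_op T -> T 0 = 0.
Proof.
move=> Tl; have T0 := linear_op_dom0 Tl.
by have [_] := linear_opB Tl T0 T0; rewrite !subrr.
Qed.

Section adjoint.
Variable T : operator H.

Lemma adjoint_graph_adjoint y :
  dom (adjoint T) y -> adjoint_graph T y (adjoint T y).
Proof. by move=> Ty; exact: (xgetPex 0 Ty). Qed.

Hypothesis Tdense : densely_defined T.

Lemma adjointE y z :
  adjoint_graph T y z -> dom (adjoint T) y /\ adjoint T y = z.
Proof.
move=> yz; have dy : dom (adjoint T) y by exists z.
split=> //; apply/subr0_eq/(dense_orthogonal Tdense) => x Tx.
by rewrite hdotBr -yz // (adjoint_graph_adjoint dy) // subrr.
Qed.

Lemma adjoint_linear : linear_op (adjoint T).
Proof.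
have comb a x y : dom (adjoint T) x -> dom (adjoint T) y ->
    adjoint_graph T (a *: x + y) (a *: adjoint T x + adjoint T y).
  move=> /adjoint_graph_adjoint dx /adjoint_graph_adjoint dy s Ts.
  by rewrite !hdotDr !hdotZr dx // dy.
split=> [|a x y dx dy]; last by case: (adjointE (comb a x y dx dy)).
apply/linear_subspaceP; split=> [|a x y dx dy].
- by exists 0 => s _; rewrite !linear0r.
- by case: (adjointE (comb a x y dx dy)).
Qed.

Lemma adjoint_closed : closed_op (adjoint T).
Proof.
apply/closed_prodP => y z app.
suff yz : adjoint_graph T y z by exact: adjointE.
move=> x Tx.
apply: hdot_eq_closed => e e0.
have [[y' z'] /= [[/= dy <-] yy' zz']] := app e e0.
by exists (y', adjoint T y'); split=> //=; rewrite (adjoint_graph_adjoint dy).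
Qed.

Lemma kernel_adjointP u :
  Defs.kernel (adjoint T) u <-> forall x, dom T x -> '[T x, u] = 0.
Proof.
split=> [[du u0] x Tx|Tu].
- by rewrite (adjoint_graph_adjoint du) // u0 linear0r.
- suff u0 : adjoint_graph T u 0 by exact: adjointE.
  by move=> x Tx; rewrite Tu // linear0r.
Qed.

Lemma kernel_adjoint_closed : closed (Defs.kernel (adjoint T)).
Proof.
apply/closed_normP => u app; apply/kernel_adjointP => x Tx.
rewrite -[RHS](linear0l (hdot H) u).
apply: (@hdot_eq_closed _ _ _ _ u u) => e e0.
have [v /kernel_adjointP Tv uv] := app e e0.
by exists (v, v); split=> //=; rewrite Tv // linear0l.
Qed.

End adjoint.

Lemma le_adjoint (T U : operator H) :
  densely_defined T -> op_le T U -> op_le (adjoint U) (adjoint T).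
Proof.
move=> Td [TU TUE].
have le y : dom (adjoint U) y -> adjoint_graph T y (adjoint U y).
  move=> /adjoint_graph_adjoint Uy x Tx.
  by rewrite (TUE _ Tx) Uy //; exact: TU.
by split=> y /le /(adjointE Td)[].
Qed.

Lemma le_adjoint_swap (T U : operator H) :
  densely_defined U -> op_le U (adjoint T) -> op_le T (adjoint U).
Proof.
move=> Ud [UTd UTE].
have le x : dom T x -> adjoint_graph U x (T x).
  move=> dx y dy.
  by rewrite UTE // hdotC -(adjoint_graph_adjoint (UTd _ dy) dx) -hdotC.
by split=> x /le /(adjointE Ud)[].
Qed.

Lemma op_eq_adjoint (T U : operator H) : op_eq T U -> adjoint T = adjoint U.
Proof.
move=> [[TU TUE] [UT _]].
suff E : adjoint_graph T = adjoint_graph U by rewrite /adjoint E.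
apply/funext => y; apply/funext => z; apply/propext; split=> yz x.
- by move=> /UT Tx; rewrite -TUE // yz.
- by move=> Tx; rewrite TUE // yz //; exact: TU.
Qed.

(** Both operators have the same graph norm. A limit point of the graph of [U]
    is approached by points [x'] with [U x'] Cauchy, hence [T x'] Cauchy; their
    limit puts [x] in the common domain, and [U x'] then tends to [U x]. *)
Lemma closed_op_equal_norms (T U : operator H) :
    linear_op T -> linear_op U -> dom T = dom U ->
    (forall x, dom T x -> `|T x| = `|U x|) ->
  closed_op T -> closed_op U.
Proof.
move=> Tl Ul TU TUn /closed_prodP Tcl; apply/closed_prodP => x y app.
have distE x1 x2 : dom U x1 -> dom U x2 -> `|T x1 - T x2| = `|U x1 - U x2|.
  move=> d1 d2; rewrite -(proj2 (linear_opB Ul d1 d2)).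
  rewrite -TU in d1 d2; have [d12 <-] := linear_opB Tl d1 d2.
  exact: TUn.
pose P d := [set z | exists x', [/\ dom U x', `|x - x'| < d,
                                    `|y - U x'| < d & z = T x']].
have [e e0|d e de _ [x' [dx' xx' yx' ->]]|e e0|p pP] :=
  @limit_of_shrinking_sets _ H P.
- have [[x' y'] /= [[/= dx' <-] xx' yy']] := app e e0.
  by exists (T x'), x'.
- by exists x'; split=> //;
    [exact: lt_le_trans xx' de|exact: lt_le_trans yx' de].
- exists (e / 2); first exact: divr_gt0.
  move=> _ _ [x1 [d1 _ yx1 ->]] [x2 [d2 _ yx2 ->]]; rewrite distE //.
  rewrite (_ : _ - _ = (y - U x2) - (y - U x1)); last first.
    by rewrite opprB [RHS]addrC subrKA.
  apply: le_lt_trans (ler_normB _ _) _.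
  by rewrite [ltRHS](splitr e) ltrD.
have [/= Tx TxE] : graph T (x, p).
  apply: Tcl => e e0; have [_ [x' [dx' xx' _ ->]] pz] := pP e e e0 e0.
  by exists (x', T x'); split=> //; split=> //=; rewrite TU.
have Ux : dom U x by rewrite -TU.
split=> //=; apply/subr0_eq/normr0_eq0.
apply: (@le_scaled_eps0 _ _ 2) => // e e0.
have [_ [x' [dx' _ yx' ->]] pz] := pP e e e0 e0.
rewrite (_ : _ - _ = (U x - U x') - (y - U x')); last first.
  by rewrite opprB addrA subrK.
apply: le_trans (ler_normB _ _) _.
by rewrite mulr_natr mulr2n lerD ?(ltW yx') // -distE // TxE ltW.
Qed.

(** The lower bound turns convergence of [T x] into convergence of [x], so the
    range of a closed [T] is closed, and its orthogonal complement is the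
    kernel of the adjoint. *)
Lemma regular_range_decomposition T w : linear_op T -> densely_defined T ->
    closed_op T -> zero_regular T ->
  exists x v, [/\ dom T x, Defs.kernel (adjoint T) v & w = T x + v].
Proof.
move=> Tl Td /closed_prodP Tcl [g g0 Tg].
pose S := [set T x | x in dom T].
have Slin : linear_subspace S.
  apply/linear_subspaceP; split=> [|a _ _ [x dx <-] [y dy <-]].
    by exists 0; [exact: linear_op_dom0|exact: linear_op0].
  by exists (a *: x + y); [exact: linear_op_dom|exact: (proj2 Tl)].
have Scl : closed S.
  apply/closed_normP => y app.
  pose P d := [set x | dom T x /\ `|y - T x| < d].
  have [e e0|d e de x [dx yx]|e e0|p pP] := @limit_of_shrinking_sets _ H P.
  - by have [_ [x dx <-] yx] := app e e0; exists x.
  - by split=> //; exact: lt_le_trans yx de.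
  - have ge0 : 0 < g * e by exact: mulr_gt0.
    exists (g * e / 2); first exact: divr_gt0.
    move=> x1 x2 [d1 yx1] [d2 yx2]; rewrite -(ltr_pM2l g0).
    have [d12 TE] := linear_opB Tl d1 d2; apply: le_lt_trans (Tg _ d12) _.
    rewrite TE (_ : _ - _ = (y - T x2) - (y - T x1)); last first.
      by rewrite opprB [RHS]addrC subrKA.
    by apply: le_lt_trans (ler_normB _ _) _; rewrite [ltRHS]splitr ltrD.
  have [/= dp Tp] : graph T (p, y).
    apply: Tcl => e e0; have [x [dx yx] px] := pP e e e0 e0.
    by exists (x, T x).
  by exists p.
have [_ [x dx <-] orth] := orthogonal_projection w Slin Scl.
exists x, (w - T x); split=> //; last by rewrite addrC subrK.
apply/(kernel_adjointP Td) => y dy.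
by apply/hdot_eq0C/orth; exists y.
Qed.

Section inverse.
Variable Q : operator H.
Hypothesis Qinv : has_bounded_everywhere_defined_inverse Q.

Lemma inverseK y : dom Q (inverse Q y) /\ Q (inverse Q y) = y.
Proof.
have [_ Qdom _] := Qinv.
have [x dx Qx] : dom (inverse Q) y by rewrite Qdom.
have Qy : [set x | dom Q x /\ Q x = y] !=set0 by exists x.
exact: (xgetPex 0 Qy).
Qed.

Lemma inverse_linear (Ql : linear_op Q) (a : K[i]) x y :
  inverse Q (a *: x + y) = a *: inverse Q x + inverse Q y.
Proof.
have [Qinj _ _] := Qinv.
have [[dx Qx] [dy Qy]] := (inverseK x, inverseK y).
have [dxy Qxy] := inverseK (a *: x + y).
apply: Qinj => //; first exact: linear_op_dom.
by rewrite Qxy (proj2 Ql) // Qx Qy.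
Qed.

Lemma inverseB (Ql : linear_op Q) x y :
  inverse Q (x - y) = inverse Q x - inverse Q y.
Proof.
by rewrite addrC -scaleN1r inverse_linear // scaleN1r addrC.
Qed.

Lemma inverse0 (Ql : linear_op Q) : inverse Q 0 = 0.
Proof.
by rewrite -[in LHS](subrr 0) inverseB // subrr.
Qed.

Lemma inverse_bounded :
  exists2 M : K[i], 0 <= M & forall y, `|inverse Q y| <= M * `|y|.
Proof.
have [_ _ [M QM]] := Qinv; exists `|M| => // y.
have q0 := le_trans (normr_ge0 _) (QM y).
by rewrite -[`|y|]normr_id -normrM ger0_norm.
Qed.

End inverse.

Lemma sqr_norm_range_kernel T x v :
    densely_defined T -> dom T x -> Defs.kernel (adjoint T) v ->
  `|T x + v| ^+ 2 = `|T x| ^+ 2 + `|v| ^+ 2.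
Proof. by move=> Td dx /(kernel_adjointP Td) Tv; rewrite pythagoras ?Tv. Qed.

End operators.

(** * The boundary decomposition of the domain of an adjoint *)

(* Keeps T x folded when T is an adjoint or an inverse. *)
Local Arguments op_fun : simpl never.

(** The hypotheses on [Q] hold for [adjoint R] as they stand and for [R] after
    exchanging [A] and [B], so the lemmas serve both adjoints. *)
Section decomposition.
Variables (K : realType) (H : hilbert K) (A B Q : operator H).
Hypotheses (Ad : densely_defined A) (Ql : linear_op Q).
Hypothesis Qinv : has_bounded_everywhere_defined_inverse Q.
Hypotheses (BQ : op_le B Q) (QA : op_le Q (adjoint A)).

Lemma adjoint_on_sum x0 v u : dom B x0 -> Defs.kernel (adjoint A) u ->
  dom (adjoint A) (x0 + inverse Q v + u) /\
  adjoint A (x0 + inverse Q v + u) = B x0 + v.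
Proof.
move=> dx0 [du u0]; have A'l := adjoint_linear Ad.
have [[BQd BQE] [QAd QAE]] := (BQ, QA).
have [dv Qv] := inverseK Qinv v.
have [dxv xvE] := linear_opD Ql (BQd _ dx0) dv.
have [d ->] := linear_opD A'l (QAd _ dxv) du.
by split=> //; rewrite u0 addr0 -QAE // xvE Qv BQE.
Qed.

(** Write [adjoint A x] as [B x0 + v]; since [x0 + inverse Q v] has the same
    image under [adjoint A], its difference with [x] is in the kernel. *)
Lemma adjoint_domain_decomposition x :
    linear_op B -> densely_defined B -> closed_op B -> zero_regular B ->
    dom (adjoint A) x ->
  exists x0 v u, [/\ dom B x0, Defs.kernel (adjoint B) v,
    Defs.kernel (adjoint A) u & x = x0 + inverse Q v + u].
Proof.
move=> Bl Bd Bcl Breg dx; have A'l := adjoint_linear Ad.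
have [x0 [v [dx0 kv AxE]]] :=
  regular_range_decomposition (adjoint A x) Bl Bd Bcl Breg.
have zero_ker : Defs.kernel (adjoint A) 0.
  by split; [exact: linear_op_dom0|exact: linear_op0].
have [] := adjoint_on_sum v dx0 zero_ker; rewrite addr0 => dxv xvE.
have [du uE] := linear_opB A'l dx dxv.
exists x0, v, (x - (x0 + inverse Q v)); split=> //.
- by split=> //; rewrite uE xvE AxE subrr.
- by rewrite addrC subrK.
Qed.

End decomposition.

(** * Normal operators and the extensions T_C *)

(** The adjoint is closed, and normality gives it the same domain and norms. *)
Lemma normal_op_closed (K : realType) (H : hilbert K)
  (N : operator H) : normal_op N -> closed_op N.
Proof.
move=> [[Nl Nd _ NE] dN].
apply: (closed_op_equal_norms (adjoint_linear Nd) Nl) (adjoint_closed Nd) => //.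
by move=> x; rewrite -dN => /NE.
Qed.

Lemma normal_op_eq (K : realType) (H : hilbert K) (N T : operator H) :
  op_eq N T -> normal_op N -> normal_op T.
Proof.
move=> NT; have [[NTd NTE] [TNd TNE]] := NT.
have domE : dom N = dom T by apply/seteqP.
rewrite /normal_op /formally_normal /linear_op /densely_defined.
rewrite -(op_eq_adjoint NT) -domE => -[[[Nlin Nadd] Nd Ndom NE] dN].
split=> //; split=> // [|x dx]; last by rewrite -NTE // NE.
split=> // a x y dx dy; rewrite -!NTE ?Nadd //.
by case/linear_subspaceP: Nlin => _; apply.
Qed.

Section extensions.
Variables (K : realType) (H : hilbert K) (A B R : operator H).
Hypotheses (hAB : adjoint_pair A B) (hA : zero_regular A) (hB : zero_regular B).
Hypotheses (hBclosed : closed_op B) (hBnormal : formally_normal B).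
Hypotheses (hdom : dom A = dom B) (hR : associated A B R).

Let Al : linear_op A. Proof. by case: hAB => -[]. Qed.
Let Ad : densely_defined A. Proof. by case: hAB => -[]. Qed.
Let Bl : linear_op B. Proof. by case: hAB => _ []. Qed.
Let Bd : densely_defined B. Proof. by case: hAB => _ []. Qed.
Let Rl : linear_op R. Proof. by case: hR => -[]. Qed.
Let Rinv : has_bounded_everywhere_defined_inverse R. Proof. by case: hR. Qed.
Let R'inv : has_bounded_everywhere_defined_inverse (adjoint R).
Proof. by case: hR. Qed.
Let AR : op_le A R. Proof. by case: hR => _ _ _ []. Qed.
Let RB' : op_le R (adjoint B). Proof. by case: hR => _ _ _ []. Qed.
Let BR' : op_le B (adjoint R). Proof. by case: hR => _ _ _ _ []. Qed.
Let R'A' : op_le (adjoint R) (adjoint A). Proof. by case: hR => _ _ _ _ []. Qed.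

Let Rd : densely_defined R. Proof. exact: dense_superset (proj1 AR) Ad. Qed.
Let R'l : linear_op (adjoint R). Proof. exact: adjoint_linear. Qed.

Lemma formally_normal_equal_norms x : dom B x -> `|B x| = `|A x|.
Proof.
move=> dx; have [_ _ _ ->] // := hBnormal.
by rewrite -hdom in dx; rewrite (proj2 AR) // (proj2 RB') //; exact: (proj1 AR).
Qed.

Let Acl : closed_op A.
Proof.
by apply: closed_op_equal_norms Bl Al _ formally_normal_equal_norms hBclosed.
Qed.

Local Notation lift p := (inverse (adjoint R) p.2 + p.1).
Local Notation lift' p := (inverse R p.1 + p.2).

Lemma lift_linear (a : K[i]) p q : lift (a *: p + q) = a *: lift p + lift q.
Proof. by rewrite /= inverse_linear // scalerDr addrACA. Qed.

(** The terms with [x0] or [y0] cancel because [adjoint B] and [adjoint A] are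
    adjoints of [B] and [A]; [R] and [adjoint R] being adjoint to each other
    cancels the products with an inverse image. *)
Lemma green_identity x0 y0 p q :
    dom B x0 -> dom A y0 -> Kspace A B p -> Kspace A B q ->
  '[B x0 + p.2, y0 + lift' q] - '[x0 + lift p, A y0 + q.1]
    = '[p.2, q.2] - '[p.1, q.1].
Proof.
move=> dx0 dy0 [kp1 kp2] [kq1 kq2].
have [] := adjoint_on_sum Bd Rl Rinv AR RB' q.1 dy0 kq2.
rewrite -addrA => dy yE.
have [] := adjoint_on_sum Ad R'l R'inv BR' R'A' p.2 (linear_op_dom0 Bl) kp1.
rewrite add0r (linear_op0 Bl) add0r => dz zE.
have eq0 := adjoint_graph_adjoint dy dx0.
have eq1 := adjoint_graph_adjoint dz dy0.
have [ds sE] := inverseK R'inv p.2; have [dr rE] := inverseK Rinv q.1.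
have := adjoint_graph_adjoint ds dr; rewrite rE sE => eq2.
rewrite !hdotDl eq0 yE !hdotDr; rewrite zE in eq1.
have {}eq1 : '[p.2, y0] = '[lift p, A y0] by rewrite hdotC -eq1 -hdotC.
have {}eq2 : '[p.2, inverse R q.1] = '[inverse (adjoint R) p.2, q.1].
  by rewrite hdotC -eq2 -hdotC.
by rewrite eq1 eq2 hdotDl; ring.
Qed.

Section TC.
Variable C : set (H * H).
Hypotheses (CK : C `<=` Kspace A B) (Clin : linear_subspace C).
Let T := TC A B R C.

Lemma dom_TC x :
  dom T x <-> exists x0 p, [/\ dom B x0, C p & x = x0 + lift p].
Proof.
split=> [[x0 [u [v [dx0 Cp ->]]]]|[x0 [[u v] [dx0 Cp ->]]]].
- by exists x0, (u, v); rewrite addrA.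
- by exists x0, u, v; rewrite addrA.
Qed.

Lemma TC_sum x0 p : dom B x0 -> C p ->
  dom T (x0 + lift p) /\ T (x0 + lift p) = B x0 + p.2.
Proof.
move=> dx0 Cp; split; first by apply/dom_TC; exists x0, p.
have [kp _] := CK Cp; rewrite addrA.
by have [] := adjoint_on_sum Ad R'l R'inv BR' R'A' p.2 dx0 kp.
Qed.

Lemma TC_le_adjoint : op_le T (adjoint A).
Proof.
split=> // x /dom_TC[x0 [p [dx0 /CK[kp _] ->]]]; rewrite addrA.
by have [] := adjoint_on_sum Ad R'l R'inv BR' R'A' p.2 dx0 kp.
Qed.

Lemma le_TC : op_le B T.
Proof.
split=> [x dx|x dx]; last first.
  by rewrite (proj2 BR') // (proj2 R'A') //; exact: (proj1 BR').
apply/dom_TC; exists x, (0, 0); split=> //.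
  by case/linear_subspaceP: Clin.
by rewrite /= inverse0 // !addr0.
Qed.

Lemma TC_dense : densely_defined T.
Proof. exact: dense_superset (proj1 le_TC) Bd. Qed.

Lemma TC_linear : linear_op T.
Proof.
have [C0 Cl] := proj1 (linear_subspaceP _) Clin.
split; last first.
  move=> a x y /(proj1 TC_le_adjoint) dx /(proj1 TC_le_adjoint) dy.
  exact: (proj2 (adjoint_linear Ad)).
apply/linear_subspaceP; split; first exact: (proj1 le_TC _ (linear_op_dom0 Bl)).
move=> a x y /dom_TC[x0 [p [dx0 Cp ->]]] /dom_TC[y0 [q [dy0 Cq ->]]].
apply/dom_TC; exists (a *: x0 + y0), (a *: p + q).
split; [exact: linear_op_dom|exact: Cl|].
by rewrite lift_linear scalerDr addrACA.
Qed.

Lemma adjoint_TC_sum y0 q : dom A y0 -> Cprime A B C q ->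
  dom (adjoint T) (y0 + lift' q) /\ adjoint T (y0 + lift' q) = A y0 + q.1.
Proof.
move=> dy0 [kq C'q]; apply: (adjointE TC_dense).
move=> x /dom_TC[x0 [p [dx0 Cp ->]]].
have [_ ->] := TC_sum dx0 Cp.
by apply/subr0_eq; rewrite green_identity // ?C'q ?subrr //; exact: CK.
Qed.

(** The adjoint of [T] lies below that of [B], so its vectors have boundary
    parts; testing against [lift p] for [p] in [C] and using Green's identity
    puts these in [Cprime A B C]. *)
Lemma dom_adjoint_TC y : dom (adjoint T) y <->
  exists y0 q, [/\ dom A y0, Cprime A B C q & y = y0 + lift' q].
Proof.
split=> [dy|[y0 [q [dy0 C'q ->]]]]; last by case: (adjoint_TC_sum dy0 C'q).
have [dy' yE] := le_adjoint Bd le_TC.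
have [y0 [u [v [dy0 ku kv yD]]]] := adjoint_domain_decomposition
  Bd Rl Rinv AR RB' Al Ad Acl hA (dy' _ dy).
have [_ By] := adjoint_on_sum Bd Rl Rinv AR RB' u dy0 kv.
exists y0, (u, v); split=> //=; last by rewrite addrA.
split=> // p Cp; apply/subr0_eq.
have Kp := CK Cp; have Kuv : Kspace A B (u, v) by [].
rewrite -(green_identity (linear_op_dom0 Bl) dy0 Kp Kuv) /=.
have [dp pE] := TC_sum (linear_op_dom0 Bl) Cp.
have := adjoint_graph_adjoint dy dp.
by rewrite pE yE // yD By -addrA => ->; rewrite subrr.
Qed.

Lemma normal_TC :
  condition_i A B R C -> condition_ii A B R C -> normal_op T.
Proof.
move=> Ci Cii.
have C_C' p : C p -> exists2 q, Cprime A B C q & lift' q = lift p.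
  move=> Cp; suff : [set lift p | p in C] (lift p) by rewrite Ci.
  by exists p.
have C'_C q : Cprime A B C q -> exists2 p, C p & lift p = lift' q.
  move=> Cq; suff : [set lift' p | p in Cprime A B C] (lift' q) by rewrite -Ci.
  by exists q.
have domE : dom T = dom (adjoint T).
  apply/seteqP; split=> x.
  - move=> /dom_TC[x0 [p [dx0 /C_C'[q C'q qp] ->]]].
    by apply/dom_adjoint_TC; exists x0, q; rewrite hdom qp.
  - move=> /dom_adjoint_TC[x0 [q [dx0 /C'_C[p Cp pq] ->]]].
    by apply/dom_TC; exists x0, p; rewrite -hdom pq.
split=> //; split; [exact: TC_linear|exact: TC_dense|by rewrite domE|].
move=> x /dom_TC[x0 [p [dx0 Cp ->]]].
have [_ ->] := TC_sum dx0 Cp.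
have [q C'q qp] := C_C' p Cp.
have ax0 : dom A x0 by rewrite hdom.
rewrite -qp; have [_ ->] := adjoint_TC_sum ax0 C'q.
have [[_ kp] [[kq _] _]] := (CK Cp, C'q).
apply/eqP; rewrite -(@eqrXn2 _ 2) //; apply/eqP.
rewrite !sqr_norm_range_kernel // formally_normal_equal_norms //.
congr (_ + _ ^+ 2).
move: p q Cp C'q qp {kp kq} => [u1 v1] [u2 v2] /= Cp C'q qp.
exact: Cii Cp C'q _.
Qed.

Section normal.
Hypothesis Tn : normal_op T.

Lemma normal_TC_norms x0 y0 p q : dom B x0 -> dom A y0 ->
    C p -> Cprime A B C q -> x0 + lift p = y0 + lift' q ->
  `|B x0| ^+ 2 + `|p.2| ^+ 2 = `|A y0| ^+ 2 + `|q.1| ^+ 2.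
Proof.
move=> dx0 dy0 Cp C'q xy.
have [[_ kp] [[kq _] _]] := (CK Cp, C'q).
rewrite -!sqr_norm_range_kernel //.
have [dx <-] := TC_sum dx0 Cp; have [_ <-] := adjoint_TC_sum dy0 C'q.
by have [[_ _ _ TE] _] := Tn; rewrite TE // xy.
Qed.

(** Applying [normal_TC_norms] to the vector minus [x0] and to the vector minus
    [y0], both again in the domain because [dom A = dom B], gives two equations
    whose sum forces [A (y0 - x0)] and [B (x0 - y0)] to vanish. *)
Lemma normal_TC_same_core x0 y0 p q : dom B x0 -> dom A y0 ->
    C p -> Cprime A B C q -> x0 + lift p = y0 + lift' q -> x0 = y0.
Proof.
move=> dx0 dy0 Cp C'q xy.
have dA0 := linear_op_dom0 Al; have dB0 := linear_op_dom0 Bl.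
have dx0A := dx0; rewrite -hdom in dx0A; have dy0B := dy0; rewrite hdom in dy0B.
have [dA _] := linear_opB Al dy0 dx0A; have [dB BE] := linear_opB Bl dx0 dy0B.
have e1 : 0 + lift p = (y0 - x0) + lift' q.
  by rewrite add0r addrAC -xy addrAC subrr add0r.
have e2 : (x0 - y0) + lift p = 0 + lift' q.
  by rewrite add0r addrAC xy addrAC subrr add0r.
have := normal_TC_norms dB0 dA Cp C'q e1.
have := normal_TC_norms dB dA0 Cp C'q e2.
rewrite (linear_op0 Bl) (linear_op0 Al) normr0 expr0n /= !add0r => <-.
rewrite -{1}[`|p.2| ^+ 2]add0r addrA => /addIr/esym/eqP.
rewrite paddr_eq0 ?exprn_ge0 // => /andP[_ /eqP nB].
have [g g0 Bg] := hB; have := Bg _ dB.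
move: nB => /eqP; rewrite expf_eq0 /= => /eqP ->.
by rewrite pmulr_rle0 // normr_le0 subr_eq0 => /eqP.
Qed.

Lemma normal_TC_i : condition_i A B R C.
Proof.
have [_ domE] := Tn; apply/seteqP; split=> _ [p Cp <-].
- have [dz _] := TC_sum (linear_op_dom0 Bl) Cp.
  have := dz; rewrite domE => /dom_adjoint_TC[y0 [q [dy0 C'q zE]]].
  have y00 := normal_TC_same_core (linear_op_dom0 Bl) dy0 Cp C'q zE.
  by exists q => //; rewrite -y00 in zE; exact: esym (addrI _ zE).
- have [dz _] := adjoint_TC_sum (linear_op_dom0 Al) Cp.
  have := dz; rewrite -domE => /dom_TC[x0 [q [dx0 Cq zE]]].
  have x00 := normal_TC_same_core dx0 (linear_op_dom0 Al) Cq Cp (esym zE).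
  by exists q => //; rewrite x00 in zE; exact: esym (addrI _ zE).
Qed.

Lemma normal_TC_ii : condition_ii A B R C.
Proof.
move=> u1 v1 u2 v2 Cp C'q zE.
have := @normal_TC_norms 0 0 (u1, v1) (u2, v2)
  (linear_op_dom0 Bl) (linear_op_dom0 Al) Cp C'q.
rewrite /= zE !linear_op0 // !normr0 expr0n /= !add0r.
move=> /(_ erefl) /eqP.
by rewrite eqrXn2 // => /eqP.
Qed.

End normal.
End TC.

Section normal_extension.
Variable N : operator H.
Hypotheses (Nn : normal_op N) (BN : op_le B N).

Let Nl : linear_op N. Proof. by case: Nn => -[]. Qed.
Let Nd : densely_defined N. Proof. by case: Nn => -[]. Qed.

(** [adjoint N] and [adjoint B] agree with [A] on [dom A = dom B], so [A] lies
    below [adjoint N]; exchange the two. *)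
Lemma normal_extension_le : op_le N (adjoint A).
Proof.
have [_ domN] := Nn; have [_ N'E] := le_adjoint Bd BN.
apply: le_adjoint_swap => //.
have AN' : dom A `<=` dom (adjoint N).
  by move=> x; rewrite hdom -domN; exact: (proj1 BN).
split=> // x dx; rewrite N'E; last exact: AN'.
by rewrite (proj2 AR) // (proj2 RB') //; exact: (proj1 AR).
Qed.

Definition extension_parameter : set (H * H) :=
  [set p | Kspace A B p /\ dom N (lift p)].
Local Notation C := extension_parameter.

Lemma extension_parameter_value p : C p -> N (lift p) = p.2.
Proof.
move=> [[kp _] dp]; rewrite (proj2 normal_extension_le) //.
have [_] := adjoint_on_sum Ad R'l R'inv BR' R'A' p.2 (linear_op_dom0 Bl) kp.
by rewrite add0r (linear_op0 Bl) add0r.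
Qed.

(** If pairs of [C] converge to [(u, v)], their lifts converge because the
    inverse of [adjoint R] is bounded, and [N] maps these lifts to the second
    components, which converge to [v]; closedness of [N] then applies. *)
Lemma extension_parameter_closed_subspace :
  closed_subspace_of_Kspace A B C.
Proof.
split=> [p []//||].
- have A'l := adjoint_linear Ad; have B'l := adjoint_linear Bd.
  have kerP (U : operator H) (a : K[i]) x y : linear_op U ->
      Defs.kernel U x -> Defs.kernel U y -> Defs.kernel U (a *: x + y).
    move=> Ul [dx x0] [dy y0]; split; first exact: linear_op_dom.
    by rewrite (proj2 Ul) // x0 y0 scaler0 addr0.
  have ker0 (U : operator H) : linear_op U -> Defs.kernel U 0.
    by move=> Ul; split; [exact: linear_op_dom0|exact: linear_op0].
  apply/linear_subspaceP; split.
    split; first by split; exact: ker0.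
    change (dom N (inverse (adjoint R) 0 + 0)).
    by rewrite inverse0 // addr0; exact: linear_op_dom0.
  move=> a p q [[kp1 kp2] dp] [[kq1 kq2] dq].
  split; first by split; exact: kerP.
  by rewrite lift_linear; exact: linear_op_dom.
- apply/closed_prodP => u v app.
  have ku : Defs.kernel (adjoint A) u.
    apply: (proj1 (closed_normP _) (kernel_adjoint_closed Ad)) => e e0.
    by have [p [[[kp _] _] up _]] := app e e0; exists p.1.
  have kv : Defs.kernel (adjoint B) v.
    apply: (proj1 (closed_normP _) (kernel_adjoint_closed Bd)) => e e0.
    by have [p [[[_ kp] _] _ vp]] := app e e0; exists p.2.
  suff [dz _] : graph N (lift (u, v), v) by [].
  apply: (proj1 (closed_prodP _) (normal_op_closed Nn)) => e e0.
  have [M M0 invM] := inverse_bounded R'inv.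
  have M1 : 0 < M + 1 by rewrite ltr_wpDl.
  (* With c <= e / (M + 1), errors below c on u and v make an error below e
     on the lift. *)
  have [c c0 [cM ce]] := gt0_common (divr_gt0 e0 M1) e0.
  have [p [Cp up vp]] := app c c0.
  exists (lift p, p.2); split=> /=; last exact: lt_le_trans vp ce.
    by split; [case: Cp|exact: extension_parameter_value].
  have -> : lift (u, v) - lift p = inverse (adjoint R) (v - p.2) + (u - p.1).
    by rewrite inverseB // opprD addrACA.
  apply: le_lt_trans (ler_normD _ _) _.
  apply: (@lt_le_trans _ _ (M * c + c)).
    apply: ler_ltD => //; apply: le_trans (invM _) _.
    by rewrite ler_wpM2l // ltW.
  by rewrite -{2}[c]mul1r -mulrDl mulrC -ler_pdivlMr.
Qed.

Lemma normal_extension_eq : op_eq N (TC A B R C).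
Proof.
have [Nd' NE] := normal_extension_le.
have NTC : dom N `<=` dom (TC A B R C).
  move=> x dx.
  have [x0 [v [u [dx0 kv ku xE]]]] := adjoint_domain_decomposition
    Ad R'l R'inv BR' R'A' Bl Bd hBclosed hB (Nd' _ dx).
  apply/dom_TC; exists x0, (u, v); split; [by []| |by rewrite addrA].
  split=> //=; rewrite (_ : _ + _ = x - x0).
    by case: (linear_opB Nl dx (proj1 BN _ dx0)).
  by rewrite xE addrAC [x0 + _]addrC addrK.
split; first by split=> // x /NE.
split=> [x /dom_TC[x0 [p [dx0 [_ dp] ->]]]|x /dom_TC[x0 [p [dx0 [_ dp] ->]]]].
  by case: (linear_opD Nl (proj1 BN _ dx0) dp).
by rewrite NE //; case: (linear_opD Nl (proj1 BN _ dx0) dp).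
Qed.

End normal_extension.
End extensions.

Theorem theorem10 (K : realType) (H : hilbert K) (A B R : operator H)
    (hAB : adjoint_pair A B)
    (hA : zero_regular A) (hB : zero_regular B)
    (hBclosed : closed_op B) (hBnormal : formally_normal B)
    (hdom : dom A = dom B)
    (hR : associated A B R) :
  (forall C : set (H * H),
     closed_subspace_of_Kspace A B C ->
     condition_i A B R C -> condition_ii A B R C ->
     [/\ normal_op (TC A B R C),
         op_le B (TC A B R C) /\ op_le (TC A B R C) (adjoint A)
       & op_le A (adjoint (TC A B R C)) /\
         op_le (adjoint (TC A B R C)) (adjoint B)])
  /\
  (forall N : operator H,
     normal_op N -> op_le B N ->
     exists C : set (H * H),
       [/\ closed_subspace_of_Kspace A B C,
           condition_i A B R C, condition_ii A B R C
         & op_eq N (TC A B R C)]).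
Proof.
split=> [C [CK Clin Ccl] Ci Cii|N Nn BN].
  have BT := le_TC hAB hR Clin; have TA' := TC_le_adjoint hAB hR CK.
  have [_ [_ Bd] _] := hAB.
  have Tn : normal_op (TC A B R C) by exact: normal_TC.
  split=> //; split; last exact: le_adjoint.
  exact: le_adjoint_swap (TC_dense hAB hR Clin) TA'.
have NC := normal_extension_eq hAB hB hBclosed hdom hR Nn BN.
have Ccl := extension_parameter_closed_subspace hAB hdom hR Nn BN.
have Tn := normal_op_eq NC Nn; have [CK Clin _] := Ccl.
exists (extension_parameter A B R N); split=> //.
- exact: normal_TC_i.
- exact: normal_TC_ii.
Qed.
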